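(* Let $m,n\ge 1$. For $i=1,2,\ldots,m$ let $S_i\subseteq\mathbb{R}^n$ be a nonempty closed polyhedral set, and let $f_i:\mathbb{R}^n\to\mathbb{R}\cup\{+\infty\}$ be a quadratic function with $\operatorname{dom} f_i=S_i$, i.e. $f_i(x)=\frac12 x^\top A_i x+b_i^\top x+c_i$ for $x\in S_i$ (with $A_i\in\mathbb{R}^{n\times n}$ symmetric, $b_i\in\mathbb{R}^n$, $c_i\in\mathbb{R}$) and $f_i(x)=+\infty$ for $x\notin S_i$. Suppose that $S_i\cap\operatorname{int} S_j=\emptyset$ for every $i\neq j$, and that $f_i(x)=f_j(x)$ for all $x\in S_i\cap S_j$. Let $\bar r_i$ be the threshold of prox-boundedness of $f_i$ for each $i$. Define $f:\mathbb{R}^n\to\mathbb{R}\cup\{+\infty\}$ by $f(x)=f_i(x)$ if $x\in S_i$ ($i=1,\ldots,m$), and $f(x)=+\infty$ if $x\notin\bigcup_{i=1}^m S_i$. Then the threshold of prox-boundedness of $f$ is $$\bar r=\max_{1\le i\le m}\bar r_i .$$ Moreover, with the active set $\mathcal{A}:=\{i:\bar r_i=\bar r\}$, $$\operatorname{dom} e_{\bar r}f=\bigcap_{i\in\mathcal{A}}\operatorname{dom} e_{\bar r}f_i .$$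
   Context: For a function $g:\mathbb{R}^n\to\mathbb{R}\cup\{-\infty,+\infty\}$, $\operatorname{dom} g:=\{x\in\mathbb{R}^n: |g(x)|<+\infty\}$. For a proper lower semicontinuous function $g:\mathbb{R}^n\to\mathbb{R}\cup\{+\infty\}$ and $r\ge 0$, the Moreau envelope is $e_rg(\bar x):=\inf_{y\in\mathbb{R}^n}\{g(y)+\frac r2\|y-\bar x\|^2\}$ (Euclidean norm), with values in $\mathbb{R}\cup\{-\infty\}$. The function $g$ is prox-bounded if there is $r\ge0$ with $e_rg(\bar x)>-\infty$ for some $\bar x\in\mathbb{R}^n$; the infimum of all such $r\ge 0$ is the threshold of prox-boundedness of $g$. A set is polyhedral if it is the intersection of finitely many closed half-spaces (the whole space being allowed). ''Quadratic'' includes the degenerate case where the matrix is zero (linear functions). *)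

(* Defs.v *)
From HB Require Import structures.
From mathcomp Require Export all_boot all_order all_algebra.
From mathcomp Require Export all_classical all_reals all_analysis.
Export Order.TTheory GRing.Theory Num.Theory.
Export numFieldNormedType.Exports.

Set Implicit Arguments.
Unset Strict Implicit.
Unset Printing Implicit Defensive.

Local Open Scope classical_set_scope.
Local Open Scope ring_scope.

(* R^n is the type 'cV[R]_n of column vectors.  Its library topology, used for
   interiors, is the usual one, but its library norm is the sup norm, so the
   Euclidean norm is defined here. *)

Definition dotv (R : realType) (n : nat) (x y : 'cV[R]_n) : R :=
  \sum_(k < n) x k 0 * y k 0.

Definition enorm (R : realType) (n : nat) (x : 'cV[R]_n) : R :=
  Num.sqrt (dotv x x).

Definition effdom (R : realType) (n : nat) (g : 'cV[R]_n -> \bar R) :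
  set 'cV[R]_n := [set x | (`|g x| < +oo)%E].

Definition moreau (R : realType) (n : nat) (r : R) (g : 'cV[R]_n -> \bar R)
  (x : 'cV[R]_n) : \bar R :=
  ereal_inf [set (g y + (r / 2 * enorm (y - x) ^+ 2)%:E)%E | y in [set: 'cV[R]_n]].

Definition prox_params (R : realType) (n : nat) (g : 'cV[R]_n -> \bar R) :
  set R := [set r | 0 <= r /\ exists x, (-oo < moreau r g x)%E].

Definition prox_bounded (R : realType) (n : nat) (g : 'cV[R]_n -> \bar R) :
  Prop := exists r, prox_params g r.

(* Meaningful only if g is prox-bounded: the library's inf of the empty set
   is 0. *)
Definition prox_threshold (R : realType) (n : nat) (g : 'cV[R]_n -> \bar R) :
  R := inf (prox_params g).

Definition closed_halfspace (R : realType) (n : nat) (a : 'cV[R]_n) (d : R) :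
  set 'cV[R]_n := [set x | dotv a x <= d].

(* k = 0 gives the whole space. *)
Definition polyhedral (R : realType) (n : nat) (S : set 'cV[R]_n) : Prop :=
  exists (k : nat) (a : 'I_k -> 'cV[R]_n) (d : 'I_k -> R),
    (forall j, a j != 0) /\
    S = \bigcap_(j in [set: 'I_k]) closed_halfspace (a j) (d j).

Definition quadratic_on (R : realType) (n : nat) (S : set 'cV[R]_n)
  (A : 'M[R]_n) (b : 'cV[R]_n) (c : R) (x : 'cV[R]_n) : \bar R :=
  if x \in S then (2^-1 * dotv x (A *m x) + dotv b x + c)%:E else +oo%E.

(* Main.v *)
Require Import Defs.
From mathcomp Require Import all_boot all_order all_algebra.
From mathcomp Require Import all_classical all_reals all_analysis.
From mathcomp Require Import ring lra.

Set Implicit Arguments.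
Unset Strict Implicit.

(** Since the [f_i] agree on overlaps and are [+oo] off their domains, [f] is
    the pointwise minimum of the [f_i].  An infimum over [y] of a minimum of
    finitely many functions is bounded below exactly when each of the infima
    is, so [e_r f (x) > -oo] if and only if [e_r f_i (x) > -oo] for all [i]
    ([moreau_gt_ninfty_min]).

    The other ingredient is that the threshold separates sharply: for every
    [r] above the threshold of [g], [e_r g] is finite from below at all points,
    not just at one ([moreau_gt_ninfty_above_threshold]).  This is because a
    quadratic of larger curvature dominates, up to a constant, a quadratic of
    smaller curvature centred anywhere else ([penalty_recentre]).

    For the threshold of [f], any [r] above all the thresholds of the [f_i] is
    admissible for each [f_i] at one common point, hence for [f]; and any [r]
    admissible for [f] is admissible for every [f_i].  For the domain, at
    [r = rbar] the inactive [f_i] have threshold below [rbar], so they impose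
    no condition on [x] and only the active ones remain.  Finally each [f_i] is
    prox-bounded because a large enough multiple of the squared norm absorbs
    any quadratic form. *)

Local Open Scope classical_set_scope.
Local Open Scope ring_scope.

(** * Moreau envelopes and their thresholds *)

Lemma enorm_sqr (R : realType) (n : nat) (x : 'cV[R]_n) :
  enorm x ^+ 2 = \sum_(k < n) x k 0 ^+ 2.
Proof.
rewrite /enorm sqr_sqrtr; last by apply: sumr_ge0 => k _; rewrite -expr2 sqr_ge0.
by apply: eq_bigr => k _; rewrite expr2.
Qed.

Lemma moreau_gt_ninftyP (R : realType) (n : nat) (r : R)
    (g : 'cV[R]_n -> \bar R) (x : 'cV[R]_n) :
  (-oo < moreau r g x)%E <->
  exists M : R, forall y, (M%:E <= g y + (r / 2 * enorm (y - x) ^+ 2)%:E)%E.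
Proof.
split=> [gx|[M gM]].
  have [M Mg] : exists M : R, (M%:E <= moreau r g x)%E.
    case: (moreau r g x) gx => [s _|_|//]; first by exists s.
    by exists 0; rewrite leey.
  exists M => y; apply: (le_trans Mg); apply: ereal_inf_lbound.
  by exists y.
apply: (@lt_le_trans _ _ M%:E); first by rewrite ltNyr.
by apply: le_ereal_inf_tmp => _ [y _ <-].
Qed.

Lemma moreau_lt_pinfty (R : realType) (n : nat) (r : R)
    (g : 'cV[R]_n -> \bar R) (x y : 'cV[R]_n) :
  (g y < +oo)%E -> (moreau r g x < +oo)%E.
Proof.
move=> gy.
apply: (@le_lt_trans _ _ (g y + (r / 2 * enorm (y - x) ^+ 2)%:E)%E).
  by apply: ereal_inf_lbound; exists y.
by apply: lte_add_pinfty => //; rewrite ltry.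
Qed.

Lemma effdom_moreauE (R : realType) (n : nat) (r : R)
    (g : 'cV[R]_n -> \bar R) :
  (exists y, (g y < +oo)%E) ->
  effdom (moreau r g) = [set x | (-oo < moreau r g x)%E].
Proof.
move=> [y gy]; apply/seteqP; split=> x /=.
  by rewrite /effdom /=; case: (moreau r g x) => [s _||] //; rewrite ltNyr.
have := moreau_lt_pinfty r x gy; rewrite /effdom /=.
by case: (moreau r g x) => // s _ _; rewrite ltry.
Qed.

(** Expanding about [x], each coordinate contributes the quadratic form
    [(r - s) / 2 * u^2 - s u w + (C - s / 2) * w^2] in [u = y_k - x_k] and
    [w = x_k - z_k], which is a perfect square for the right [C]. *)
Lemma penalty_recentre (R : realType) (n : nat) (s r : R) (x z : 'cV[R]_n) :
  s < r -> exists K : R, forall y : 'cV[R]_n,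
    s / 2 * enorm (y - z) ^+ 2 <= r / 2 * enorm (y - x) ^+ 2 + K.
Proof.
move=> sr; have rs0 : 0 < r - s by rewrite subr_gt0.
pose C := s / 2 + s ^+ 2 / (2 * (r - s)).
exists (C * enorm (x - z) ^+ 2) => y.
rewrite !enorm_sqr !mulr_sumr -big_split /=; apply: ler_sum => k _.
rewrite !mxE; set u := y k 0; set v := x k 0; set w := z k 0.
rewrite -subr_ge0.
have -> : r / 2 * (u - v) ^+ 2 + C * (v - w) ^+ 2 - s / 2 * (u - w) ^+ 2 =
    ((r - s) * (u - v) - s * (v - w)) ^+ 2 / (2 * (r - s)).
  by rewrite /C; field; rewrite gt_eqF.
by rewrite divr_ge0 ?sqr_ge0 // mulr_ge0 // ltW.
Qed.

Lemma moreau_gt_ninfty_lt (R : realType) (n : nat) (s r : R)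
    (g : 'cV[R]_n -> \bar R) (x z : 'cV[R]_n) :
  s < r -> (-oo < moreau s g z)%E -> (-oo < moreau r g x)%E.
Proof.
move=> sr /moreau_gt_ninftyP[M gM]; apply/moreau_gt_ninftyP.
have [K pen] := penalty_recentre x z sr.
exists (M - K) => y; move: (gM y) (pen y).
case: (g y) => [t||] //=; last by move=> _ _; rewrite addye // leey.
by rewrite -!EFinD !lee_fin; lra.
Qed.

Lemma prox_threshold_ge0 (R : realType) (n : nat) (g : 'cV[R]_n -> \bar R) :
  prox_bounded g -> 0 <= prox_threshold g.
Proof. by move=> pg; apply: lb_le_inf => // r []. Qed.

Lemma prox_threshold_le (R : realType) (n : nat) (g : 'cV[R]_n -> \bar R)
    (r : R) : prox_params g r -> prox_threshold g <= r.
Proof. by move=> gr; apply: ge_inf => //; exists 0 => s []. Qed.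

Lemma moreau_gt_ninfty_above_threshold (R : realType) (n : nat)
    (g : 'cV[R]_n -> \bar R) (r : R) (x : 'cV[R]_n) :
  prox_bounded g -> prox_threshold g < r -> (-oo < moreau r g x)%E.
Proof.
move=> pg gr.
have [s [_ [z gz]] sr] : exists2 s, prox_params g s & s < r.
  exact: inf_lt.
exact: moreau_gt_ninfty_lt sr gz.
Qed.

(** * Pointwise minima of finitely many functions *)

Lemma moreau_gt_ninfty_min (R : realType) (m n : nat) (r : R)
    (g : 'I_m -> 'cV[R]_n -> \bar R) (f : 'cV[R]_n -> \bar R) (x : 'cV[R]_n)
    (f_le : forall i y, (f y <= g i y)%E) (f_att : forall y, exists i, f y = g i y) :
  (-oo < moreau r f x)%E <-> forall i, (-oo < moreau r (g i) x)%E.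
Proof.
split=> [/moreau_gt_ninftyP[M fM] i|gx].
  apply/moreau_gt_ninftyP; exists M => y; apply: (le_trans (fM y)).
  exact: leeD2r.
have /choice[M gM] : forall i, exists M : R, forall y,
    (M%:E <= g i y + (r / 2 * enorm (y - x) ^+ 2)%:E)%E.
  by move=> i; apply/moreau_gt_ninftyP.
apply/moreau_gt_ninftyP; exists (\big[Num.min/0]_i M i) => y.
have [i ->] := f_att y; apply: (le_trans _ (gM i y)).
by rewrite lee_fin; apply: bigmin_le_cond.
Qed.

Lemma prox_params_min_above (R : realType) (m n : nat)
    (g : 'I_m -> 'cV[R]_n -> \bar R) (f : 'cV[R]_n -> \bar R)
    (f_le : forall i y, (f y <= g i y)%E) (f_att : forall y, exists i, f y = g i y)
    (g_bounded : forall i, prox_bounded (g i)) (r : R) :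
  \big[Num.max/0]_(i < m) prox_threshold (g i) < r -> prox_params f r.
Proof.
move=> gr; split; first by apply: le_trans (ltW gr); apply: bigmax_ge_id.
exists 0; apply/(moreau_gt_ninfty_min r 0 f_le f_att) => i.
apply: moreau_gt_ninfty_above_threshold => //.
by apply: le_lt_trans gr; apply: le_bigmax_cond.
Qed.

Lemma prox_threshold_min (R : realType) (m n : nat)
    (g : 'I_m -> 'cV[R]_n -> \bar R) (f : 'cV[R]_n -> \bar R)
    (f_le : forall i y, (f y <= g i y)%E) (f_att : forall y, exists i, f y = g i y)
    (g_bounded : forall i, prox_bounded (g i)) :
  prox_bounded f /\
  prox_threshold f = \big[Num.max/0]_(i < m) prox_threshold (g i).
Proof.
have above := prox_params_min_above f_le f_att g_bounded.
have f_bounded : prox_bounded f.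
  exists (\big[Num.max/0]_(i < m) prox_threshold (g i) + 1).
  by apply: above; rewrite ltrDl ltr01.
split=> //; apply/le_anti/andP; split.
  apply/ler_addgt0Pr => e e0; apply: prox_threshold_le; apply: above.
  by rewrite ltrDl.
apply: bigmax_le => [|i _]; first exact: prox_threshold_ge0.
apply: lb_le_inf => // r [r0 [x fx]]; apply: prox_threshold_le; split=> //.
by exists x; move/(moreau_gt_ninfty_min r x f_le f_att): fx; apply.
Qed.

(** * Quadratic functions *)

(** Entrywise, [x_k A_kl x_l >= - |A_kl| * |x|^2], by the inequality
    [2 |x_k x_l| <= x_k^2 + x_l^2 <= 2 |x|^2]. *)
Lemma quadratic_form_lower_bound (R : realType) (n : nat) (A : 'M[R]_n)
    (x : 'cV[R]_n) :
  - (\sum_k \sum_l `|A k l|) * enorm x ^+ 2 <= dotv x (A *m x).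
Proof.
rewrite mulNr mulr_suml -sumrN; apply: ler_sum => k _.
rewrite mxE mulr_suml -sumrN mulr_sumr; apply: ler_sum => l _.
have coord_le j : x j 0 ^+ 2 <= enorm x ^+ 2.
  rewrite enorm_sqr (bigD1 j) //= lerDl.
  by apply: sumr_ge0 => i _; apply: sqr_ge0.
have xkl : `|x k 0 * x l 0| <= enorm x ^+ 2.
  rewrite ler_norml; move: (coord_le k) (coord_le l).
  have := sqr_ge0 (x k 0 - x l 0); have := sqr_ge0 (x k 0 + x l 0).
  by move=> *; apply/andP; split; lra.
have -> : x k 0 * (A k l * x l 0) = A k l * (x k 0 * x l 0) by ring.
rewrite lerNl; apply: (le_trans (ler_norm _)).
by rewrite normrN normrM; apply: ler_wpM2l.
Qed.

Lemma linear_form_lower_bound (R : realType) (n : nat) (b x : 'cV[R]_n) :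
  - (2^-1 * enorm b ^+ 2) - 2^-1 * enorm x ^+ 2 <= dotv b x.
Proof.
rewrite !enorm_sqr !mulr_sumr -!sumrN -big_split /=; apply: ler_sum => k _.
by have := sqr_ge0 (b k 0 + x k 0); lra.
Qed.

Lemma prox_bounded_quadratic (R : realType) (n : nat) (S : set 'cV[R]_n)
    (A : 'M[R]_n) (b : 'cV[R]_n) (c : R) : prox_bounded (quadratic_on S A b c).
Proof.
(* The extra 1 absorbs the linear term. *)
exists (\sum_k \sum_l `|A k l| + 1); split.
  by rewrite addr_ge0 //; apply: sumr_ge0 => k _; apply: sumr_ge0.
exists 0; apply/moreau_gt_ninftyP; exists (c - 2^-1 * enorm b ^+ 2) => y.
rewrite subr0 /quadratic_on; case: ifP => _; last by rewrite addye // leey.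
rewrite -EFinD lee_fin.
by have := quadratic_form_lower_bound A y; have := linear_form_lower_bound b y; lra.
Qed.

(* The maximum below may start from 0 since thresholds are nonnegative. *)
Theorem theorem4p11 (R : realType) (m n : nat) (hm : (0 < m)%N) (hn : (0 < n)%N)
  (S : 'I_m -> set 'cV[R]_n)
  (A : 'I_m -> 'M[R]_n) (b : 'I_m -> 'cV[R]_n) (c : 'I_m -> R)
  (fi : 'I_m -> 'cV[R]_n -> \bar R) (f : 'cV[R]_n -> \bar R)
  (S_nonempty : forall i, S i !=set0)
  (S_polyhedral : forall i, polyhedral (S i))
  (A_sym : forall i, (A i)^T = A i)
  (fiE : forall i x, fi i x = quadratic_on (S i) (A i) (b i) (c i) x)
  (S_interior : forall i j, i != j -> S i `&` interior (S j) = set0)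
  (fi_compat : forall i j x, S i x -> S j x -> fi i x = fi j x)
  (f_in : forall i x, S i x -> f x = fi i x)
  (f_out : forall x, ~ (\bigcup_(i in [set: 'I_m]) S i) x -> f x = +oo%E) :
  let rbar := \big[Num.max/0]_(i < m) prox_threshold (fi i) in
  let active := [set i : 'I_m | prox_threshold (fi i) = rbar] in
  [/\ forall i, prox_bounded (fi i),
      prox_bounded f,
      prox_threshold f = rbar
    & effdom (moreau rbar f) = \bigcap_(i in active) effdom (moreau rbar (fi i))].
Proof.
move=> rbar active.
have fiB i : prox_bounded (fi i).
  rewrite (_ : fi i = quadratic_on (S i) (A i) (b i) (c i)); last first.
    by apply/funext => x; apply: fiE.
  exact: prox_bounded_quadratic.
have fi_out i y : ~ S i y -> fi i y = +oo%E.
  by move=> Sy; rewrite fiE /quadratic_on memNset.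
have f_le i y : (f y <= fi i y)%E.
  have [Sy|Sy] := pselect (S i y); first by rewrite (f_in i y Sy).
  by rewrite fi_out // leey.
have f_att y : exists i, f y = fi i y.
  have [[i _ Sy]|NSy] := pselect ((\bigcup_(i in [set: 'I_m]) S i) y).
    by exists i; apply: f_in.
  (* Off the union every fi is +oo, so any index will do. *)
  exists (Ordinal hm); rewrite f_out // fi_out // => Sy.
  by apply: NSy; exists (Ordinal hm).
have fi_proper i : exists y, (fi i y < +oo)%E.
  have [y Sy] := S_nonempty i.
  by exists y; rewrite fiE /quadratic_on mem_set // ltry.
have f_proper : exists y, (f y < +oo)%E.
  have [y fy] := fi_proper (Ordinal hm).
  by exists y; apply: le_lt_trans (f_le _ y) fy.
have [fB fT] := prox_threshold_min f_le f_att fiB.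
split=> //; rewrite (effdom_moreauE _ f_proper); apply/seteqP; split=> x.
  move=> /(moreau_gt_ninfty_min rbar x f_le f_att) fx i _.
  by rewrite (effdom_moreauE _ (fi_proper i)); apply: fx.
move=> act_x; apply/(moreau_gt_ninfty_min rbar x f_le f_att) => i.
have [iact|inact] := eqVneq (prox_threshold (fi i)) rbar.
  by have := act_x i iact; rewrite (effdom_moreauE _ (fi_proper i)).
apply: moreau_gt_ninfty_above_threshold => //.
by rewrite lt_neqAle inact; apply: le_bigmax_cond.
Qed.
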